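(* Let $H=\mathbb F_2^r$ with $r\ge2$, and consider the associated Cayley game with the unique odd target on $O_0$. The coefficient assignment $E_g\mapsto-1$, $O_g\mapsto1$ ($g\in H$) is a PREF, but no true refutation exists. Consequently, the game has commuting-operator value one and no perfect MERP strategy.
   Context: Cayley game of $H=\mathbb F_2^r$ (written additively): the players are indexed by $\alpha\in H$, each player has question set $H$, and there are $2|H|$ clauses, all of equal weight $1/(2|H|)$: for each $g\in H$, the clause $E_g$ with question tuple $(g)_{\alpha\in H}$ (every player gets $g$), and the clause $O_g$ with question tuple $(g+\alpha)_{\alpha\in H}$. The target parity $b_e\in\mathbb F_2$ is $1$ for $e=O_0$ and $0$ for all other clauses. For a clause $e$ let $q_e^{(\alpha)}$ denote the question of player $\alpha$; on clause $e$ the players answer bits $a_\alpha$ and win iff $\bigoplus_\alpha a_\alpha=b_e$. Let $A$ be the clause-by-player-question incidence matrix: $A_{e,(\alpha,j)}=1$ if $q_e^{(\alpha)}=j$, else $0$. A PREF is an integer vector $y$ indexed by clauses with $A^{\mathsf T}y=0$ and $b^{\mathsf T}y\equiv1\pmod2$. A clause word $w=e_1\cdots e_N$ (any finite length, repetitions allowed) is balanced if for each player $\alpha$ the projected word $q_{e_1}^{(\alpha)}\cdots q_{e_N}^{(\alpha)}$, viewed in the free product of copies of $\mathbb Z_2$ (one involutive generator per question), equals the identity. A true refutation is a balanced word in which the number of occurrences $t$ with $b_{e_t}=1$ is odd. A commuting-operator strategy is a complex Hilbert space $\mathcal H$, a unit vector $\psi$, and bounded self-adjoint involutions $A_{\alpha,j}$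 on $\mathcal H$ such that operators of distinct players commute; its success probability is $\sum_e\frac{p_e}{2}\bigl(1+(-1)^{b_e}\langle\psi,\prod_\alpha A_{\alpha,q_e^{(\alpha)}}\psi\rangle\bigr)$ with $p_e$ the clause weights, and the commuting-operator value is the supremum over all such strategies. A MERP strategy is given by real angles $\theta_{\alpha,j}$: with $n=|H|$ players sharing $(|0\rangle^{\otimes n}+|1\rangle^{\otimes n})/\sqrt2$, player $\alpha$ on question $j$ measures $\cos\theta_{\alpha,j}X+\sin\theta_{\alpha,j}Y$ (Pauli matrices) on its qubit, output bit $a$ corresponding to eigenvalue $(-1)^a$. It is perfect if every clause is won with certainty; equivalently $\sum_\alpha\theta_{\alpha,q_e^{(\alpha)}}=\pi b_e\pmod{2\pi}$ for every clause $e$. *)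

(* Defs.v *)
From HB Require Import structures.
From Stdlib Require Import Relation_Operators.
From mathcomp Require Import all_boot all_order all_algebra.
From mathcomp Require Import all_classical all_reals all_analysis.
From mathcomp Require Import sesquilinear complex.

Set Implicit Arguments.
Unset Strict Implicit.
Unset Printing Implicit Defensive.

Import Order.TTheory GRing.Theory Num.Theory.
Import numFieldNormedType.Exports.

Local Open Scope classical_set_scope.
Local Open Scope complex_scope.
Local Open Scope ring_scope.

(* Parities, elements of F_2 in the mathematics, are booleans added with
   [addb]: [true] stands for 1. *)
Record xor_game (R : realType) := XorGame {
  player : finType;
  question : finType;
  clause : finType;
  query : clause -> player -> question;
  target : clause -> bool;
  weight : clause -> R }.

Section Refutations.
Variables (R : realType) (G : xor_game R).

Definition incidence (e : clause G) (aj : player G * question G) : int :=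
  (query e aj.1 == aj.2)%:R.

Definition is_PREF (y : clause G -> int) : Prop :=
  (forall aj, \sum_(e : clause G) incidence e aj * y e = 0) /\
  (\sum_(e : clause G) (target e)%:R * y e = 1 %[mod 2])%Z.

(* The free product of copies of Z_2, one for each element of Q, is presented by
   the generators Q and the relations q q = 1. Each generator being its own
   inverse, its elements are words over Q modulo the equivalence generated by
   inserting and deleting factors q q. *)
Inductive cancel_step (Q : Type) : seq Q -> seq Q -> Prop :=
  CancelStep s q t : cancel_step (s ++ [:: q, q & t]) (s ++ t).

Definition eq_free_product (Q : Type) : seq Q -> seq Q -> Prop :=
  clos_refl_sym_trans (seq Q) (@cancel_step Q).

Definition balanced (w : seq (clause G)) : Prop :=
  forall a : player G, eq_free_product [seq query e a | e <- w] [::].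

Definition true_refutation (w : seq (clause G)) : Prop :=
  balanced w /\ odd (count (@target R G) w).

End Refutations.

Section CommutingOperator.
Variables (R : realType) (G : xor_game R).

(* A complex Hilbert space is a complete normed space over R[i] whose norm comes
   from an inner product; [{dot _ for conjC}] is linear in its first argument. *)
Record co_strategy := COStrategy {
  co_space : completeNormedModType R[i];
  co_inner : {dot co_space for Num.conj};
  co_innerE : forall v, co_inner v v = `|v| ^+ 2;
  co_state : co_space;
  co_state_unit : `|co_state| = 1;
  co_obs : player G -> question G -> {linear co_space -> co_space};
  co_obs_bounded : forall a j, exists M : R[i],
    forall v, `|co_obs a j v| <= M * `|v|;
  co_obs_selfadjoint : forall a j u v,
    co_inner (co_obs a j u) v = co_inner u (co_obs a j v);
  co_obs_involutive : forall a j, involutive (co_obs a j);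
  co_obs_commute : forall a a' j j', a != a' -> forall v,
    co_obs a j (co_obs a' j' v) = co_obs a' j' (co_obs a j v) }.

(* The operators being multiplied belong to distinct players, so the order of
   the product is irrelevant. *)
Definition co_prod (S : co_strategy) (e : clause G) : co_space S -> co_space S :=
  \big[comp/idfun]_(a : player G) (co_obs S a (query e a) : _ -> _).

(* The inner product below is real, since the operator [co_prod e] is
   self-adjoint; [complex.Re] only changes its type. *)
Definition co_success (S : co_strategy) : R :=
  \sum_(e : clause G) weight e / 2 *
    (1 + (-1) ^+ target e *
      complex.Re (co_inner S (co_state S) (co_prod e (co_state S)))).

Definition co_value : R := sup [set p | exists S : co_strategy, p = co_success S].

End CommutingOperator.

Section MERP.
Variables (R : realType) (G : xor_game R).

Definition pauliX : 'M[R[i]]_2 := \matrix_(i, j) (if i == j then 0 else 1).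

Definition pauliY : 'M[R[i]]_2 :=
  \matrix_(i, j) (if i == j then 0 else if i == 0 then - 'i%C else 'i%C).

Definition merp_obs (t : R) : 'M[R[i]]_2 :=
  (cos t)%:C *: pauliX + (sin t)%:C *: pauliY.

(* [merp_obs t] squares to the identity, so this is the orthogonal projection on
   its eigenspace for the eigenvalue (-1)^a. *)
Definition merp_proj (t : R) (a : bool) : 'M[R[i]]_2 :=
  2^-1 *: (1%:M + (-1) ^+ a *: merp_obs t).

(* Vectors of the tensor product of the players' qubits, by their coordinates in
   the computational basis. *)
Definition qubits := {ffun player G -> 'I_2} -> R[i].

Definition ghz : qubits := fun s =>
  ((Num.sqrt 2)^-1)%:C *
  ((s == [ffun=> 0] :> {ffun player G -> 'I_2})%:R +
   (s == [ffun=> 1] :> {ffun player G -> 'I_2})%:R).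

Definition tensor_apply (M : player G -> 'M[R[i]]_2) (psi : qubits) : qubits :=
  fun s => \sum_(t : {ffun player G -> 'I_2}) (\prod_a M a (s a) (t a)) * psi t.

Definition merp_strategy := player G -> question G -> R.

(* Born rule: probability of the joint answer [ans] on clause [e]. *)
Definition merp_prob (theta : merp_strategy) (e : clause G)
    (ans : {ffun player G -> bool}) : R[i] :=
  \sum_(s : {ffun player G -> 'I_2})
    `|tensor_apply (fun a => merp_proj (theta a (query e a)) (ans a)) ghz s| ^+ 2.

Definition merp_win_prob (theta : merp_strategy) (e : clause G) : R[i] :=
  \sum_(ans : {ffun player G -> bool} |
        \big[addb/false]_(a : player G) ans a == target e)
    merp_prob theta e ans.

Definition merp_perfect (theta : merp_strategy) : Prop :=
  forall e : clause G, merp_win_prob theta e = 1.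

End MERP.

Section Cayley.
Variables (R : realType) (r : nat).

Local Notation H := 'rV['F_2]_r.

(* The clause E_g is [inl g] and the clause O_g is [inr g]. *)
Definition cayley_query (e : H + H) (alpha : H) : H :=
  match e with inl g => g | inr g => g + alpha end.

Definition cayley_game : xor_game R := {|
  player := H;
  question := H;
  clause := (H + H)%type;
  query := cayley_query;
  target := fun e => e == inr 0;
  weight := fun=> (2 * #|{: H}|)%:R^-1 |}.

Definition cayley_assignment (e : clause cayley_game) : int :=
  match e with inl _ => -1 | inr _ => 1 end.

End Cayley.

(* Main.v *)
Require Import Defs.
From HB Require Import structures.
From mathcomp Require Import all_boot all_order all_algebra.
From mathcomp Require Import all_classical all_reals all_analysis.
From mathcomp Require Import sesquilinear complex.
From mathcomp Require Import ring.
Local Open Scope ring_scope.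

(** A perfect commuting-operator strategy excludes true refutations: evaluated
    on the observables, a balanced word gives the identity, whereas it
    multiplies the state by (-1) to the number of its odd clauses. So it
    suffices to find one, and it may live on the four players and four
    questions of a subgroup F_2^2 of H, all other observables being the
    identity.

    Each of these players holds a qubit and a copy of C^4, and measures an
    observable which swaps the two values of the qubit and acts on C^4 by W_q
    or by its inverse. Here W_00 is the cyclic shift, W_01 the clock matrix
    diag(i^y), W_10 the inverse of their product up to an eighth root of
    unity, and W_11 = 1. As shift and clock commute up to the factor i, the
    four-fold tensor products W_e attached to the clauses commute with each
    other. The product of the W_e over the clauses E_g is 1, whereas over the
    clauses O_g it is -1, because two players meet the three nontrivial
    matrices in reversed cyclic order, at the cost of a factor -i each. Hence
    some vector phi is negated by W_e for e = O_0 and fixed by all other W_e,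
    and the state (|0000> + |1111>) phi wins every clause.

    A perfect MERP strategy would give unit complex numbers, one for each
    player and question, whose product is 1 over every clause but O_0, and -1
    over O_0. But every player meets every question once among the E_g and
    once among the O_g, so the products over all E_g and over all O_g agree. *)

Set Implicit Arguments.
Unset Strict Implicit.
Unset Printing Implicit Defensive.

Import Order.TTheory GRing.Theory Num.Theory.
Import numFieldNormedType.Exports.

(** * Finite-dimensional Hilbert spaces *)

Local Notation conjC := Num.conj.

Definition l2 (C : numClosedFieldType) (I : finType) := {ffun I -> C}.

Section EuclideanSpace.
Variables (C : numClosedFieldType) (I : finType).
Implicit Types f g : l2 C I.

HB.instance Definition _ := GRing.Lmodule.on (l2 C I).

Definition l2_inner (f g : l2 C I) : C := \sum_i f i * conjC (g i).

Definition l2_norm (f : l2 C I) : C := sqrtC (l2_inner f f).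

Fact l2_inner_bilinear :
  bilinear_for *%R (conjC \; *%R) l2_inner.
Proof.
split=> [g a f h | f a g h]; rewrite /l2_inner /= mulr_sumr -big_split /=.
  by apply: eq_bigr => i _; rewrite !ffunE mulrDl mulrA.
by apply: eq_bigr => i _; rewrite !ffunE rmorphD rmorphM mulrDr mulrCA.
Qed.

HB.instance Definition _ := bilinear_isBilinear.Build C (l2 C I) (l2 C I) C
  *%R (conjC \; *%R) l2_inner l2_inner_bilinear.

Fact l2_inner_hermitian f g :
  l2_inner f g = (-1) ^+ false * conjC (l2_inner g f).
Proof.
rewrite mul1r rmorph_sum; apply: eq_bigr => i _.
by rewrite rmorphM /= conjCK mulrC.
Qed.

HB.instance Definition _ := isHermitianSesquilinear.Build C (l2 C I) false
  conjC l2_inner l2_inner_hermitian.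

Lemma l2_innerE f : l2_inner f f = \sum_i `|f i| ^+ 2.
Proof. by apply: eq_bigr => i _; rewrite normCK. Qed.

Fact l2_inner_gt0 f : f != 0 -> 0 < l2_inner f f.
Proof.
move=> f_neq0; rewrite l2_innerE lt_def sumr_ge0 ?andbT => [|i _]; last first.
  by rewrite exprn_ge0.
apply: contraNN f_neq0; rewrite psumr_eq0 => [/allP f0|i _]; last first.
  by rewrite exprn_ge0.
apply/eqP/ffunP => i; rewrite ffunE; apply/eqP.
by have := f0 i (mem_index_enum i); rewrite sqrf_eq0 normr_eq0.
Qed.

HB.instance Definition _ := isDotProduct.Build C (l2 C I) l2_inner l2_inner_gt0.

Fact l2_norm_ge0 f : 0 <= l2_norm f.
Proof.
by rewrite sqrtC_ge0 l2_innerE sumr_ge0 // => i _; rewrite exprn_ge0.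
Qed.

Fact l2_norm_sqr f : l2_norm f ^+ 2 = \sum_i `|f i| ^+ 2.
Proof. by rewrite sqrtCK l2_innerE. Qed.

Fact l2_norm_eq0 f : l2_norm f = 0 -> f = 0.
Proof.
move/eqP; rewrite sqrtC_eq0 => f0; apply/eqP; apply: contraTT f0.
by move/l2_inner_gt0; rewrite lt_def => /andP[].
Qed.

Fact l2_normZ a f : l2_norm (a *: f) = `|a| * l2_norm f.
Proof.
apply/eqP; rewrite -(@eqrXn2 _ 2) ?mulr_ge0 ?l2_norm_ge0 // exprMn !l2_norm_sqr.
by rewrite mulr_sumr; apply/eqP/eq_bigr => i _; rewrite ffunE normrM exprMn.
Qed.

(* Cauchy-Schwarz: expand [0 <= \sum_i (|f| |g_i| - |g| |f_i|)^2]. *)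
Fact l2_cauchy_schwarz f g : \sum_i `|f i| * `|g i| <= l2_norm f * l2_norm g.
Proof.
have [/l2_norm_eq0 ->|f0] := eqVneq (l2_norm f) 0.
  rewrite big1 ?mulr_ge0 ?l2_norm_ge0 // => i _.
  by rewrite ffunE normr0 mul0r.
have [/l2_norm_eq0 ->|g0] := eqVneq (l2_norm g) 0.
  rewrite big1 ?mulr_ge0 ?l2_norm_ge0 // => i _.
  by rewrite ffunE normr0 mulr0.
set a := l2_norm f in f0 *; set b := l2_norm g in g0 *.
have ab0 : 0 < a * b by rewrite mulr_gt0 // lt_def ?f0 ?g0 l2_norm_ge0.
have : 0 <= \sum_i (a * `|g i| - b * `|f i|) ^+ 2.
  apply: sumr_ge0 => i _; rewrite real_exprn_even_ge0 // rpredB // ger0_real //.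
    by rewrite mulr_ge0 ?l2_norm_ge0.
  by rewrite mulr_ge0 ?l2_norm_ge0.
have -> : \sum_i (a * `|g i| - b * `|f i|) ^+ 2 =
    a * b * (a * b - \sum_i `|f i| * `|g i|) *+ 2.
  have -> : a * b * (a * b - \sum_i `|f i| * `|g i|) *+ 2 =
      a ^+ 2 * (\sum_i `|g i| ^+ 2) + b ^+ 2 * (\sum_i `|f i| ^+ 2)
        - (a * b * \sum_i `|f i| * `|g i|) *+ 2.
    by rewrite -!l2_norm_sqr -/a -/b; ring.
  rewrite !mulr_sumr -big_split /= -sumrMnl -sumrB.
  by apply: eq_bigr => i _; ring.
by rewrite pmulrn_lge0 // pmulr_rge0 // subr_ge0.
Qed.

(** After squaring, the triangle inequality in each coordinate leaves a cross term, which
    Cauchy-Schwarz bounds. *)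
Fact ler_l2_normD f g : l2_norm (f + g) <= l2_norm f + l2_norm g.
Proof.
rewrite -(@ler_pXn2r _ 2) ?nnegrE ?addr_ge0 ?l2_norm_ge0 //.
rewrite sqrrD !l2_norm_sqr.
apply: (@le_trans _ _ (\sum_i (`|f i| + `|g i|) ^+ 2)).
  apply: ler_sum => i _.
  by rewrite ler_pXn2r ?nnegrE ?addr_ge0 // ffunE ler_normD.
under eq_bigr do rewrite sqrrD.
by rewrite !big_split /= lerD2r lerD2l mulr2n lerD ?l2_cauchy_schwarz.
Qed.

HB.instance Definition _ := Lmodule_isNormed.Build C (l2 C I)
  ler_l2_normD l2_normZ l2_norm_eq0.

Lemma l2_normE (f : l2 C I) : `|f| ^+ 2 = \sum_i `|f i| ^+ 2.
Proof. exact: l2_norm_sqr. Qed.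

Lemma ler_coord_l2_norm (f : l2 C I) i : `|f i| <= `|f|.
Proof.
rewrite -(@ler_pXn2r _ 2) ?nnegrE // l2_normE (bigD1 i) //= lerDl.
by apply: sumr_ge0 => j _; rewrite exprn_ge0.
Qed.

Lemma ler_l2_norm_sum (f : l2 C I) : `|f| <= \sum_i `|f i|.
Proof.
rewrite -(@ler_pXn2r _ 2) ?nnegrE ?sumr_ge0 // l2_normE expr2 mulr_suml.
apply: ler_sum => i _; rewrite expr2 ler_wpM2l // (bigD1 i) //= lerDl.
exact: sumr_ge0.
Qed.

End EuclideanSpace.

(** * Completeness of the finite-dimensional spaces *)

Section EuclideanCompleteness.
Local Open Scope classical_set_scope.
Local Open Scope complex_scope.
Variables (R : realType) (I : finType).
Local Notation E := (l2 R[i] I).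

(** A 1-Lipschitz function maps a Cauchy filter to a Cauchy filter, and [R] is complete. It is
    applied to the real and imaginary parts of the coordinates. *)
Lemma cauchy_lipschitz_cvg (F : set_system E) (u : E -> R) :
    ProperFilter F -> cauchy F ->
    (forall f g, `|u f - u g|%:C <= `|f - g|) ->
  exists l : R, forall e : R, 0 < e -> \forall f \near F, `|l - u f| < e.
Proof.
move=> FF Fc u_lip.
have uF_proper : ProperFilter (u @ F) by exact: fmap_proper_filter.
have uFc : cauchy (u @ F).
  apply/cauchy_ballP => e e0.
  have /cauchy_ballP/(_ e%:C) := Fc; rewrite ltcR => /(_ e0).
  move=> Fe; rewrite near_map2; apply: filterS Fe => -[f g] /=.
  rewrite -ball_normE /= => fg; rewrite -ball_normE /= -ltcR.
  exact: le_lt_trans (u_lip f g) fg.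
have uF_cvg := R_complete uF_proper uFc.
exists (lim (u @ F)) => e e0.
by have /cvgrPdist_lt/(_ e e0) := uF_cvg.
Qed.

Lemma ler_norm_ReIm (z : R[i]) :
  `|z| <= `|complex.Re z|%:C + `|complex.Im z|%:C.
Proof.
rewrite [in X in X <= _](complexE z) (le_trans (ler_normD _ _)) //.
rewrite normrM; have -> : `|'i%C : R[i]| = 1 by rewrite complexiE normCi.
by rewrite mul1r !normc_def /= !expr0n /= !addr0 !sqrtr_sqr.
Qed.

Lemma normc_ge_Im (z : R[i]) : `|complex.Im z|%:C <= `|z|.
Proof.
rewrite -normrN -ReiNIm (le_trans (normc_ge_Re _)) // normrM.
by rewrite complexiE normCi mulr1.
Qed.

Fact l2_complete (F : set_system E) : ProperFilter F -> cauchy F -> cvg F.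
Proof.
move=> FF Fc.
have Re_lip i (f g : E) :
    `|complex.Re (f i) - complex.Re (g i)|%:C <= `|f - g| :> R[i].
  apply: le_trans (ler_coord_l2_norm _ i); rewrite !ffunE.
  by apply: le_trans (normc_ge_Re _); rewrite (raddfB (@complex.Re R)).
have Im_lip i (f g : E) :
    `|complex.Im (f i) - complex.Im (g i)|%:C <= `|f - g| :> R[i].
  apply: le_trans (ler_coord_l2_norm _ i); rewrite !ffunE.
  by apply: le_trans (normc_ge_Im _); rewrite (raddfB (@complex.Im R)).
have /choice [lRe lReP] := fun i => cauchy_lipschitz_cvg FF Fc (Re_lip i).
have /choice [lIm lImP] := fun i => cauchy_lipschitz_cvg FF Fc (Im_lip i).
apply/cvg_ex; exists ([ffun i => lRe i +i* lIm i] : E).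
apply/cvgrPdist_lt => e e0.
have [eE Re0] : e = (complex.Re e)%:C /\ 0 < complex.Re e.
  move: e0; rewrite ltcE /= => /andP[/eqP Ie ?]; split=> //.
  by rewrite [LHS]complexE Ie rmorph0 mulr0 addr0.
(* Each coordinate contributes at most [2 * d]; the successor makes the total strictly less than [e]
   and avoids a zero denominator when [I] is empty. *)
pose d := complex.Re e / (2 *+ #|I|.+1).
have d0 : 0 < d by rewrite divr_gt0 // pmulrn_lgt0.
have nearRe := filter_forall FF (fun i => lReP i d d0).
have nearIm := filter_forall FF (fun i => lImP i d d0).
near=> f; rewrite eE; apply: (@le_lt_trans _ _ (\sum_(i : I) (d *+ 2)%:C)).
  apply: le_trans (ler_l2_norm_sum _) _; apply: ler_sum => i _; rewrite !ffunE.
  apply: le_trans (ler_norm_ReIm _) _.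
  rewrite (raddfB (@complex.Re R)) (raddfB (@complex.Im R)) /= -rmorphD lecR.
  rewrite mulr2n lerD // ltW //.
    by move: i; near: f.
  by move: i; near: f.
rewrite sumr_const -rmorphMn ltcR /= -mulrnA -mulr_natr mulrAC.
rewrite ltr_pdivrMr ?pmulrn_lgt0 // ltr_pM2l // -[2 *+ _]mulrnA.
by rewrite ltr_nat ltn_pmul2l.
Unshelve. all: by end_near. Qed.

HB.instance Definition _ := Uniform_isComplete.Build E l2_complete.

End EuclideanCompleteness.

(** * Perfect commuting-operator strategies *)

Section CommutingProducts.
Variables (T : Type) (P : eqType).
Implicit Types (f g : P -> T -> T) (s : seq P).

Lemma eq_comp_prod f g s : (forall a, a \in s -> f a =1 g a) ->
  \big[comp/idfun]_(a <- s) f a =1 \big[comp/idfun]_(a <- s) g a.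
Proof.
elim: s => [|a s IH] fg x; first by rewrite !big_nil.
rewrite !big_cons /= IH ?fg ?mem_head // => b bs.
by apply: fg; rewrite in_cons bs orbT.
Qed.

Lemma comp_prod_id f s : (forall a, a \in s -> f a =1 id) ->
  \big[comp/idfun]_(a <- s) f a =1 id.
Proof.
move=> f_id x; rewrite (eq_comp_prod (g := fun=> idfun)) //.
by elim: s {f_id} => [|a s IH]; rewrite ?big_nil ?big_cons.
Qed.

Lemma comp_prod_cat f s t x : (\big[comp/idfun]_(a <- s ++ t) f a) x =
  (\big[comp/idfun]_(a <- s) f a) ((\big[comp/idfun]_(a <- t) f a) x).
Proof. by elim: s => [|a s IH]; rewrite ?big_nil // !big_cons /= IH. Qed.

Lemma comp_prod_comm f (h : T -> T) s :
  (forall a, a \in s -> forall x, h (f a x) = f a (h x)) -> forall x,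
  h ((\big[comp/idfun]_(a <- s) f a) x) = (\big[comp/idfun]_(a <- s) f a) (h x).
Proof.
elim: s => [|a s IH] hf x; first by rewrite big_nil.
rewrite big_cons /= hf ?mem_head // IH // => b bs.
by apply: hf; rewrite in_cons bs orbT.
Qed.

Lemma comp_prodM f g s : uniq s ->
  (forall a b, a != b -> forall x, g a (f b x) = f b (g a x)) ->
  \big[comp/idfun]_(a <- s) (f a \o g a) =1
    \big[comp/idfun]_(a <- s) f a \o \big[comp/idfun]_(a <- s) g a.
Proof.
move=> s_uniq fg; elim: s s_uniq => [_|a s IH /= /andP[a_s s_uniq]] x.
  by rewrite !big_nil.
rewrite !big_cons /= IH //= -(@comp_prod_comm f (g a)) // => b bs.
by apply: fg; apply: contraNneq a_s => ->.
Qed.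

Lemma perm_comp_prod f s t : uniq s -> perm_eq s t ->
    (forall a b, a != b -> forall x, f a (f b x) = f b (f a x)) ->
  \big[comp/idfun]_(a <- s) f a =1 \big[comp/idfun]_(a <- t) f a.
Proof.
move=> + + fC; elim: s t => [|a s IH] t.
  by move=> _ /perm_size/esym/size0nil ->.
move=> /= /andP[a_s s_uniq] st x.
have at_ : a \in t by rewrite -(perm_mem st) mem_head.
case/splitPr: at_ st => t1 t2; rewrite perm_sym perm_catC /= perm_cons => st.
have st' : perm_eq s (t1 ++ t2) by rewrite perm_sym perm_catC.
rewrite big_cons /= (IH _ s_uniq st') !comp_prod_cat big_cons /=.
rewrite (@comp_prod_comm f (f a)) // => b bt.
apply: fC; apply: contraNneq a_s => ->.
by rewrite (perm_mem st') mem_cat bt.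
Qed.

(** Serves to cut a product over all players in H down to the four players of the subgroup. *)
Lemma comp_prod_support f s t :
    uniq s -> uniq t -> {subset t <= s} ->
    (forall a b, a != b -> forall x, f a (f b x) = f b (f a x)) ->
    (forall a, a \notin t -> f a =1 id) ->
  \big[comp/idfun]_(a <- s) f a =1 \big[comp/idfun]_(a <- t) f a.
Proof.
move=> s_uniq t_uniq ts fC f_id x.
have st : perm_eq s (t ++ [seq a <- s | a \notin t]).
  apply: uniq_perm => // [|a].
    rewrite cat_uniq t_uniq filter_uniq // andbT /=.
    by apply/hasPn => a; rewrite mem_filter => /andP[].
  rewrite mem_cat mem_filter; have [/ts ->|] := boolP (a \in t) => //.
rewrite (perm_comp_prod s_uniq st fC) comp_prod_cat; congr (_ _).
by apply: comp_prod_id => a; rewrite mem_filter => /andP[/f_id].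
Qed.

End CommutingProducts.

(** * Clause operators, refutations and success probabilities *)

Section PerfectStrategies.
Variables (R : realType) (G : xor_game R) (S : co_strategy G).
Local Notation psi := (co_state S).
Local Notation U := (@co_prod R G S).

Definition co_perfect :=
  forall e, U e psi = (-1) ^+ target e *: psi.

Lemma co_prod_scale e c v : U e (c *: v) = c *: U e v.
Proof.
rewrite /co_prod; elim: (index_enum _) => [|a s IH]; first by rewrite !big_nil.
by rewrite !big_cons /= IH linearZ.
Qed.

Lemma norm_co_prod e v : `|U e v| = `|v|.
Proof.
rewrite /co_prod; elim: (index_enum _) => [|a s IH]; first by rewrite big_nil.
rewrite big_cons /= -[RHS]IH; apply/eqP; rewrite -(@eqrXn2 _ 2) //.
by rewrite -!(@co_innerE _ _ S) co_obs_selfadjoint co_obs_involutive.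
Qed.

(** Observables of distinct players commute, so the product along a word can be regrouped player by
    player, each along its projected word. *)
Lemma co_prod_word (w : seq (clause G)) :
  \big[comp/idfun]_(e <- w) U e =1
  \big[comp/idfun]_(a : player G)
    \big[comp/idfun]_(j <- [seq query e a | e <- w]) (co_obs S a j : _ -> _).
Proof.
elim: w => [|e w IH] v.
  by rewrite big_nil comp_prod_id // => a _ x; rewrite big_nil.
pose W a := \big[comp/idfun]_(j <- [seq query e a | e <- w])
  (co_obs S a j : _ -> co_space S).
rewrite big_cons /= IH [RHS](@eq_comp_prod _ _ _
  (fun a => (co_obs S a (query e a) : _ -> co_space S) \o W a)); last first.
  by move=> a _ x; rewrite /= big_cons.
rewrite (comp_prodM (index_enum_uniq _)) // => a b ab x.
rewrite [RHS](@comp_prod_comm _ _ _ (co_obs S b (query e b))) // => j _ y.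
by apply: co_obs_commute; rewrite eq_sym.
Qed.

(** A cancelled factor [q q] becomes the square of an observable, which is the identity. *)
Lemma eq_free_product_obs a (s t : seq (question G)) : eq_free_product s t ->
  \big[comp/idfun]_(j <- s) (co_obs S a j : _ -> _) =1
  \big[comp/idfun]_(j <- t) (co_obs S a j : _ -> _).
Proof.
elim=> {s t} [_ _ [s q t] x|//|s t _ IH x|s t u _ IHs _ IHt x].
- by rewrite !comp_prod_cat !big_cons /= co_obs_involutive.
- by rewrite IH.
- by rewrite IHs.
Qed.

Lemma co_perfect_no_refutation (w : seq (clause G)) :
  co_perfect -> ~ true_refutation w.
Proof.
move=> S_perfect [w_bal w_odd].
have wK : (\big[comp/idfun]_(e <- w) U e) psi = psi.
  rewrite co_prod_word comp_prod_id // => a _ x.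
  by rewrite (eq_free_product_obs a (w_bal a)) big_nil.
have : (\big[comp/idfun]_(e <- w) U e) psi =
    (-1) ^+ count (@target R G) w *: psi.
  elim: w {w_bal w_odd wK} => [|e w IH]; first by rewrite big_nil scale1r.
  by rewrite big_cons /= IH co_prod_scale S_perfect scalerA -exprD addnC.
(* Now [psi = - psi], so [psi] vanishes, against its norm being 1. *)
rewrite wK -signr_odd w_odd expr1 scaleN1r => /eqP.
rewrite -subr_eq0 opprK -mulr2n -scaler_nat scaler_eq0 pnatr_eq0 /= => /eqP p0.
by have := co_state_unit S; rewrite p0 normr0 => /eqP; rewrite eq_sym oner_eq0.
Qed.

Lemma co_inner_signr (b : bool) u v :
  co_inner S u ((-1) ^+ b *: v) = (-1) ^+ b * co_inner S u v.
Proof. by rewrite linearZr_LR /= rmorph_sign. Qed.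

(** Expand the nonnegative squared norm of [psi - (-1) ^+ b *: U e psi], in which both vectors have
    norm 1. *)
Lemma Re_co_inner_le1 e (b : bool) :
  (-1) ^+ b * complex.Re (co_inner S psi (U e psi)) <= 1.
Proof.
set v := U e psi; set z := co_inner S psi v.
have psi1 : co_inner S psi psi = 1 by rewrite co_innerE co_state_unit expr1n.
have v1 : co_inner S v v = 1.
  by rewrite co_innerE norm_co_prod co_state_unit expr1n.
have := dnorm_ge0 (co_inner S) (psi - (-1) ^+ b *: v).
rewrite hnormB hnorm_sign /= psi1 v1 co_inner_signr mul1r.
rewrite rmorphM rmorph_sign /=.
rewrite -mulrDr -/z [z + _]addcJ mulrCA -[1 + 1]/(2%:R) -{1}[2%:R]mulr1 -mulrBr.
rewrite pmulr_rge0 ?ltr0n // subr_ge0 => le1; rewrite -(lecR _ 1).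
by rewrite rmorphM rmorph_sign.
Qed.

Lemma co_success_le1 : (forall e : clause G, 0 <= weight e) ->
  \sum_(e : clause G) weight e = 1 -> co_success S <= 1.
Proof.
move=> w_ge0 <-; apply: ler_sum => e _; rewrite -mulrA ler_piMr // mulrC.
by rewrite ler_pdivrMr // mul1r -[2]/(1 + 1) lerD2l Re_co_inner_le1.
Qed.

Lemma co_success_perfect : \sum_(e : clause G) weight e = 1 ->
  co_perfect -> co_success S = 1.
Proof.
move=> w1 S_perfect; rewrite -[RHS]w1; apply: eq_bigr => e _.
rewrite S_perfect co_inner_signr co_innerE co_state_unit expr1n mulr1.
have -> : complex.Re ((-1) ^+ target e : R[i]) = (-1) ^+ target e.
  by case: target => /=; rewrite ?expr0 ?expr1.
by rewrite -expr2 sqrr_sign -[1 + 1]/(2%:R) divfK ?pnatr_eq0.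
Qed.

End PerfectStrategies.

Lemma co_value_perfect (R : realType) (G : xor_game R) (S : co_strategy G) :
    (forall e : clause G, 0 <= weight e) -> \sum_(e : clause G) weight e = 1 ->
  co_perfect S -> co_value G = 1.
Proof.
move=> w_ge0 w1 S_perfect; apply/eqP; rewrite eq_le; apply/andP; split.
  apply: ge_sup; first by exists (co_success S); exists S.
  by move=> _ [S' ->]; exact: co_success_le1.
apply: ub_le_sup; last by exists S; rewrite co_success_perfect.
by exists 1 => _ [S' ->]; exact: co_success_le1.
Qed.

(** * Perfect MERP strategies *)

Section MerpStrategies.
Local Open Scope complex_scope.
Variables (R : realType) (G : xor_game R) (a0 : player G).
Implicit Types (theta : merp_strategy G) (ans : {ffun player G -> bool}).

Definition phase (t : R) : R[i] := cos t +i* sin t.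

Lemma norm_phase t : `|phase t| = 1.
Proof. by rewrite normc_def /= cos2Dsin2 sqrtr1. Qed.

Lemma phaseJK t : Num.conj (phase t) * phase t = 1.
Proof. by rewrite mulrC -normCK norm_phase expr1n. Qed.

Lemma merp_projE t b (i j : 'I_2) : merp_proj t b i j =
  2^-1 * (if i == j then 1 else
          (-1) ^+ b * (if i == 0 then Num.conj (phase t) else phase t)).
Proof.
rewrite !mxE; congr (_ * _); have [ij|ij] := eqVneq i j.
  by rewrite !mulr0 addr0 mulr0 addr0.
rewrite add0r mulr1; congr (_ * _).
by case: ifP => _; apply/eqP; rewrite eq_complex /=; apply/andP; split;
  apply/eqP; ring.
Qed.

Lemma norm_merp_proj_col0 (t : R) b i : `|merp_proj t b i 0| = 2^-1.
Proof.
rewrite merp_projE normrM normfV normr_nat; case: ifP => _.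
  by rewrite normr1 mulr1.
rewrite normrM normrX normrN1 expr1n.
by case: ifP => _; rewrite ?norm_conjC norm_phase !mulr1.
Qed.

(** The projection has rank one, so its columns are proportional. *)
Lemma merp_proj_col1 (t : R) b i :
  merp_proj t b i 1 = (-1) ^+ b * Num.conj (phase t) * merp_proj t b i 0.
Proof.
rewrite !merp_projE; case: (altP (i =P 0)) => [->|i0] /=.
  by rewrite mulr1 mulrC.
have -> : i = 1 by apply/val_inj; case: i i0 => [[|[|]]].
rewrite eqxx /= mulr1 mulrCA -mulrA [Num.conj _ * _]mulrCA phaseJK mulr1.
by rewrite -[X in _ = _ * X]expr2 sqrr_sign mulr1.
Qed.

Definition parity ans := \big[addb/false]_(a : player G) ans a.

(** Flipping the answer of the player [a0] is a bijection between the two parity classes. *)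
Lemma card_parity b : #|[pred ans | parity ans == b]|.*2 = (2 ^ #|player G|)%N.
Proof.
pose toggle ans : {ffun player G -> bool} := [ffun a => ans a (+) (a == a0)].
have toggleK : involutive toggle.
  by move=> ans; apply/ffunP => a; rewrite !ffunE -addbA addbb addbF.
have parity_toggle ans : parity (toggle ans) = ~~ parity ans.
  rewrite /parity (eq_bigr (fun a => ans a (+) (a == a0))); last first.
    by move=> a _; rewrite ffunE.
  rewrite big_split /= -addbT; congr (_ (+) _).
  by rewrite (bigD1 a0) //= eqxx big1 // => a /negPf.
have -> : (2 ^ #|player G|)%N = #|{: {ffun player G -> bool}}|.
  by rewrite card_ffun card_bool.
rewrite -(cardC [pred ans | parity ans == b]) -addnn; congr (_ + _)%N.
rewrite -(fintype.card_image (inv_inj toggleK)); apply: eq_card => ans.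
rewrite -[ans]toggleK fintype.mem_image; last exact: inv_inj.
by rewrite !inE !parity_toggle; case: (parity ans); case: b.
Qed.

Lemma ghz_sum (F : {ffun player G -> 'I_2} -> R[i]) :
  \sum_t F t * @ghz R G t = (Num.sqrt 2)^-1%:C * (F [ffun=> 0] + F [ffun=> 1]).
Proof.
have neq01 : [ffun=> 1] != [ffun=> 0] :> {ffun player G -> 'I_2}.
  by apply/eqP => /ffunP /(_ a0); rewrite !ffunE.
rewrite (bigD1 [ffun=> 0]) //= (bigD1 [ffun=> 1]) //= big1 => [|t]; last first.
  by rewrite /ghz => /andP[/negPf -> /negPf ->]; rewrite addr0 !mulr0.
rewrite /ghz !eqxx (negPf neq01) (eq_sym _ [ffun=> 1]) (negPf neq01) /=; ring.
Qed.

Lemma merp_probE theta e ans :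
  merp_prob theta e ans = 2 ^- #|player G| / 2 *
    `|1 + (-1) ^+ parity ans
          * Num.conj (\prod_a phase (theta a (query e a)))| ^+ 2.
Proof.
set P := (-1) ^+ _ * _.
pose M a := merp_proj (theta a (query e a)) (ans a).
(* By [merp_proj_col1] the two branches of the GHZ state contribute amplitudes
   in the ratio [1 : P] at every basis vector. *)
have amplitude s : tensor_apply M (@ghz R G) s =
    (Num.sqrt 2)^-1%:C * ((1 + P) * \prod_a M a (s a) 0).
  rewrite /tensor_apply ghz_sum; congr (_ * _); rewrite mulrDl mul1r.
  congr (_ + _); first by apply: eq_bigr => a _; rewrite ffunE.
  rewrite (eq_bigr (fun a =>
    (-1) ^+ ans a * Num.conj (phase (theta a (query e a))) * M a (s a) 0));
    last first.
    by move=> a _; rewrite ffunE merp_proj_col1.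
  rewrite !big_split /= -rmorph_prod; congr (_ * _ * _).
  apply/esym/(big_morph (fun b : bool => (-1) ^+ b : R[i])) => // b c.
  exact: signr_addb.
set n := #|player G|.
(* All [2 ^ n] basis vectors are equally likely, because the first-column entries of the projections
   have modulus 1/2. *)
rewrite /merp_prob (eq_bigr (fun=> 2^-1 * `|1 + P| ^+ 2 * (4^-1) ^+ n)).
  have half : (4^-1) ^+ n * 2 ^+ n = 2 ^- n :> R[i].
    by rewrite -exprMn -exprVn; congr (_ ^+ _); field.
  rewrite sumr_const card_ffun card_ord -[LHS]mulr_natr natrX -mulrA half.
  by rewrite mulrC mulrA.
move=> s _; rewrite amplitude !normrM !exprMn normr_prod.
under eq_bigr => a _ do rewrite norm_merp_proj_col0.
rewrite prodr_const mulrA -exprM mulnC exprM; congr (_ * _ * _).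
  rewrite normc_def /= expr0n addr0 sqrtr_sqr ger0_norm ?invr_ge0 ?sqrtr_ge0 //.
  by rewrite -rmorphXn exprVn sqr_sqrtr // fmorphV rmorph_nat.
by congr (_ ^+ _); field.
Qed.

(** Half of the answer tuples win, all with the same probability, and these add up to
    [|1 + P|^2 / 4] for a unit [P]. Certainty thus forces [P = 1]. *)
Lemma merp_perfect_phase theta e : merp_perfect theta ->
  \prod_a phase (theta a (query e a)) = (-1) ^+ target e.
Proof.
move=> /(_ e); rewrite /merp_win_prob; set z := \prod_a _.
pose P := (-1) ^+ target e * Num.conj z.
have z1 : `|z| = 1.
  by rewrite normr_prod big1 // => a _; exact: norm_phase.
have P1 : `|P| = 1 by rewrite normrM normr_sign norm_conjC z1 mulr1.
rewrite (eq_bigr (fun=> 2 ^- #|player G| / 2 * `|1 + P| ^+ 2)); last first.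
  by move=> ans /eqP ansE; rewrite merp_probE /parity ansE.
rewrite sumr_const -[X in X = 1 -> _]mulr_natr; set N := #|_|%:R => win.
have N2 : N * 2 = 2 ^+ #|player G|.
  rewrite -[RHS]natrX -(card_parity (target e)) -muln2 natrM.
  by congr (_%:R * _); exact: eq_card.
have P4 : `|1 + P| ^+ 2 = 4.
  have n0 : 2 ^+ #|player G| != 0 :> R[i] by rewrite expf_neq0 ?pnatr_eq0.
  have N0 : N != 0 by apply: contraNneq n0 => N0; rewrite -N2 N0 mul0r.
  rewrite -[RHS](mulr1 4) -[X in 4 * X]win -N2; field.
  exact: N0.
(* Parallelogram law: [|1 - P|^2 + |1 + P|^2 = 2 + 2 |P|^2 = 4]. *)
have /eqP : `|1 - P| ^+ 2 = 0.
  have PP : P * Num.conj P = 1 by rewrite -normCK P1 expr1n.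
  move: P4; rewrite !normCK !rmorphD rmorphN rmorph1 /= => P4.
  have -> : (1 - P) * (1 - Num.conj P) =
      2 + 2 * (P * Num.conj P) - (1 + P) * (1 + Num.conj P) by ring.
  by rewrite P4 PP; ring.
rewrite sqrf_eq0 normr_eq0 subr_eq0 => /eqP PE.
have zE : Num.conj z = (-1) ^+ target e.
  rewrite -[LHS]mul1r -[X in X * _](sqrr_sign _ (target e)) expr2 -mulrA.
  by rewrite -/P -PE mulr1.
by rewrite -[z]conjCK zE rmorph_sign.
Qed.

End MerpStrategies.

(** * The Cayley game: PREF and MERP strategies *)

Section CayleyGame.
Variables (R : realType) (r : nat).
Local Notation H := 'rV['F_2]_r.
Local Notation G := (cayley_game R r).

(** Player [a] meets question [j] in exactly two clauses, E_j and O_(j - a), whose coefficients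
    cancel. Only O_0 contributes to the parity. *)
Lemma cayley_PREF : is_PREF (@cayley_assignment R r).
Proof.
split=> [[a j]|]; rewrite big_sumType /=.
  rewrite /incidence /= (bigD1 j) //= eqxx big1 => [|g /negPf ->]; last first.
    by rewrite mul0r.
  rewrite (bigD1 (j - a)) //= subrK eqxx big1 => [|g]; last first.
    move=> g_neq; rewrite (_ : (g + a == j) = false) ?mul0r //.
    by apply: contraNF g_neq => /eqP <-; rewrite addrK.
  by rewrite !addr0 !mul1r addNr.
rewrite big1 => [|g _]; last by rewrite mul0r.
rewrite (bigD1 0) //= eqxx big1 => [|g /negPf g0]; first by rewrite add0r addr0.
by rewrite (_ : (inr g == inr 0) = false) ?mul0r.
Qed.

Lemma cayley_no_perfect_merp (theta : merp_strategy G) : ~ merp_perfect theta.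
Proof.
move=> perfect.
have phaseE e := merp_perfect_phase (0 : player G) e perfect.
have : \prod_(g : H) \prod_a phase (theta a (query (inl g : clause G) a)) =
       \prod_(g : H) \prod_a phase (theta a (query (inr g : clause G) a)).
  rewrite exchange_big [RHS]exchange_big; apply: eq_bigr => a _ /=.
  by rewrite [LHS](reindex_inj (addIr a)).
rewrite big1 => [|g _]; last exact: (phaseE (inl g)).
rewrite (eq_bigr (fun g => (-1) ^+ (g == 0))) => [|g _]; last first.
  exact: (phaseE (inr g)).
rewrite (bigD1 0) //= eqxx big1 => [|g /negPf ->]; last by rewrite expr0.
rewrite mulr1 expr1 => /eqP; rewrite -subr_eq0 opprK.
by rewrite -[1 + 1]/(2%:R) pnatr_eq0.
Qed.

End CayleyGame.

(** * Operators acting on one site of a tensor product *)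

Section SiteOperators.
Variables (C : numClosedFieldType) (P L : finType).
Implicit Types (p : P) (t : L -> L) (s : L -> C) (f g : l2 C {ffun P -> L}).

(* Functions on [{ffun P -> L}] are vectors of the tensor product over [P] of
   copies of [l2 C L]; [site_op p t s] acts on the factor [p] by the monomial
   matrix [f |-> s * (f \o t)]. *)
Definition site_update p t (x : {ffun P -> L}) : {ffun P -> L} :=
  [ffun i => if i == p then t (x p) else x i].

Definition site_op p t s f : l2 C {ffun P -> L} :=
  [ffun x : {ffun P -> L} => s (x p) * f (site_update p t x)].

Fact site_op_linear p t s : linear (site_op p t s).
Proof. by move=> a f g; apply/ffunP => x; rewrite !ffunE mulrDr mulrCA. Qed.

HB.instance Definition _ p t s :=
  GRing.isLinear.Build C _ _ _ (site_op p t s) (site_op_linear p t s).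

Lemma site_updateK p t : involutive t -> involutive (site_update p t).
Proof.
move=> tK x; apply/ffunP => i; rewrite !ffunE eqxx tK.
by case: eqP => [->|].
Qed.

Lemma site_updateC p q t u x : p != q ->
  site_update p t (site_update q u x) = site_update q u (site_update p t x).
Proof.
move=> pq; apply/ffunP => i; rewrite !ffunE (negPf pq) (eq_sym q) (negPf pq).
by case: (i =P p) => [->|//]; rewrite (negPf pq).
Qed.

Lemma site_op_comm p q t u s v f : p != q ->
  site_op p t s (site_op q u v f) = site_op q u v (site_op p t s f).
Proof.
move=> pq; apply/ffunP => x.
rewrite !ffunE (negPf pq) (eq_sym q) (negPf pq) mulrCA.
by rewrite site_updateC // eq_sym.
Qed.

Section Unitary.
Variables (p : P) (t : L -> L) (s : L -> C).
Hypotheses (tK : involutive t) (norm_s : forall l, `|s l| = 1).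
Hypothesis (s_t : forall l, s l * s (t l) = 1).

Lemma site_opK : involutive (site_op p t s).
Proof.
move=> f; apply/ffunP => x; rewrite !ffunE eqxx site_updateK // mulrA s_t.
by rewrite mul1r.
Qed.

(** Since [s l] has modulus 1 and [s l * s (t l) = 1], the value [s (t l)] is the conjugate of
    [s l]; substituting along [t] then moves the operator to the other side. *)
Lemma site_op_selfadjoint f g :
  l2_inner (site_op p t s f) g = l2_inner f (site_op p t s g).
Proof.
rewrite /l2_inner (reindex_inj (inv_inj (site_updateK p tK))).
apply: eq_bigr => x _; rewrite !ffunE eqxx site_updateK // rmorphM /=.
rewrite [s _ * _]mulrC -mulrA; congr (_ * (_ * _)).
rewrite -[LHS]mul1r -(expr1n _ 2) -(norm_s (x p)) normCK [s (x p) * _]mulrC.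
by rewrite -mulrA s_t mulr1.
Qed.

Lemma norm_site_op f : `|site_op p t s f| = `|f|.
Proof.
apply/eqP; rewrite -(@eqrXn2 _ 2) // !l2_normE -!l2_innerE.
by rewrite site_op_selfadjoint site_opK.
Qed.

End Unitary.
End SiteOperators.

(** * Eighth roots of unity *)

Section EighthRoot.
Variable C : numClosedFieldType.

Definition zeta8 : C := sqrtC 'i.

(** Phases are handled as exponents in ['Z_8], where equations can be decided by evaluation; this
    character turns them into scalars. *)
Definition chi8 (k : 'Z_8) : C := zeta8 ^+ k.

Lemma zeta8_4 : zeta8 ^+ 4 = -1.
Proof. by rewrite (exprM _ 2 2) sqrtCK sqrCi. Qed.

Lemma chi8D k l : chi8 (k + l) = chi8 k * chi8 l.
Proof.
rewrite /chi8 -exprD expr_mod // (exprM _ 4 2) zeta8_4.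
by rewrite sqrrN expr1n.
Qed.

Lemma norm_chi8 k : `|chi8 k| = 1.
Proof.
have zeta8_1 : `|zeta8| = 1.
  by apply/eqP; rewrite -(@pexpr_eq1 _ _ 4) // -normrX zeta8_4 normrN1.
by rewrite normrX zeta8_1 expr1n.
Qed.

Lemma chi8_sign (b : bool) : chi8 (if b then 4%:R else 0) = (-1) ^+ b.
Proof. by case: b; rewrite /chi8 ?expr0 // zeta8_4. Qed.

End EighthRoot.

(** * A perfect strategy for the Cayley game of F_2^2 *)

Section KleinStrategy.
Local Notation P := (bool * bool)%type.
Local Notation site := (bool * 'Z_4)%type.

Definition addP (p q : P) : P := (p.1 (+) q.1, p.2 (+) q.2).

(* Question [q] has the unitary W_q of the header, namely
   [(W_q f)(y) = chi8 (weyl_phase p q y) * f (y + weyl_shift q)] for the player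
   [p]. The sign of W_(1,0) is changed for the player [(1,0)]: it moves the odd
   target to O_0. *)
Definition weyl_shift (q : P) : 'Z_4 :=
  match q with
  | (false, false) => 1
  | (true, false) => -1
  | _ => 0
  end.

Definition weyl_phase (p q : P) (y : 'Z_4) : 'Z_8 :=
  match q with
  | (false, true) => inZp (2 * y)
  | (true, false) => (if p == (true, false) then 5%:R else 1) - inZp (2 * y)
  | _ => 0
  end.

(* The boolean of a site is the qubit: the observable swaps its two values and
   acts by W_q or by its inverse accordingly. *)
Definition site_move (q : P) (l : site) : site :=
  (~~ l.1, if l.1 then l.2 + weyl_shift q else l.2 - weyl_shift q).

(** For the inverse of W_q the phase is negated and taken at the point reached after undoing the
    shift. *)
Definition site_phase (p q : P) (l : site) : 'Z_8 :=
  if l.1 then weyl_phase p q l.2 else - weyl_phase p q (l.2 - weyl_shift q).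

Lemma site_moveK q : involutive (site_move q).
Proof. by case=> [[] y]; rewrite /site_move /= ?addrK ?subrK. Qed.

Lemma site_phase_move p q l :
  site_phase p q l + site_phase p q (site_move q l) = 0.
Proof. by case: l => [[] y]; rewrite /site_phase /= ?addrK ?subrr ?addNr. Qed.

(* The joint eigenvector, found by propagating the eigenvalue equations from the
   amplitude 1 at the origin; [None] is the amplitude 0. *)
Definition state_phase (l0 l1 l2 l3 : site) : option 'Z_8 :=
  let: (b, y0) := l0 in let: (b1, y1) := l1 in
  let: (b2, y2) := l2 in let: (b3, y3) := l3 in
  if [&& b == b1, b == b2, b == b3, y0 + y2 == y1 + y3
       & ~~ odd (y0 + y2)%R] then
    Some (if odd (y0 + y1)%R then 7%:R else if y0 == y3 then 0 else 4%:R)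
  else None.

Definition klein_query (e : P + P) (p : P) : P :=
  match e with inl q => q | inr q => addP q p end.

(** The eigenvector equation of clause [e] at one basis vector, written with exponents: 4 stands for
    the sign -1, and the amplitudes on the two sides must vanish together. *)
Definition state_check (e : P + P) (l0 l1 l2 l3 : site) : bool :=
  let q := klein_query e in
  let p0 := (false, false) in let p1 := (false, true) in
  let p2 := (true, false) in let p3 := (true, true) in
  match state_phase l0 l1 l2 l3,
        state_phase (site_move (q p0) l0) (site_move (q p1) l1)
          (site_move (q p2) l2) (site_move (q p3) l3) with
  | Some k, Some k' =>
      site_phase p0 (q p0) l0 + (site_phase p1 (q p1) l1 +
      (site_phase p2 (q p2) l2 + (site_phase p3 (q p3) l3 + k')))
        == (if e == inr p0 then 4%:R else 0) + k
  | None, None => true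
  | _, _ => false
  end.

Definition bits : seq P :=
  [seq (b, c) | b <- [:: false; true], c <- [:: false; true]].

Lemma mem_bits p : p \in bits. Proof. by case: p => [[] []]. Qed.

Definition digits : seq 'Z_4 := [seq inZp k | k <- iota 0 4].

Lemma mem_digits y : y \in digits.
Proof. by case: y => [[|[|[|[|]]]] ?]. Qed.

(** Finite verification over 8 clauses, 2 values of the common qubit bit and 256 choices of
    digits. *)
Lemma state_check_all : all (fun e => all (fun b =>
    all (fun y0 => all (fun y1 => all (fun y2 => all (fun y3 =>
      state_check e (b, y0) (b, y1) (b, y2) (b, y3))
    digits) digits) digits) digits) [:: false; true])
  ([seq inl q | q <- bits] ++ [seq inr q | q <- bits]).
Proof. by vm_compute. Qed.

Lemma state_checkP e l0 l1 l2 l3 : state_check e l0 l1 l2 l3.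
Proof.
have e_mem : e \in [seq inl q | q <- bits] ++ [seq inr q | q <- bits].
  by rewrite mem_cat; case: e => q; rewrite map_f ?mem_bits ?orbT.
have equal_bits b y0 y1 y2 y3 : state_check e (b, y0) (b, y1) (b, y2) (b, y3).
  have b_mem : b \in [:: false; true] by case: b.
  move: state_check_all => /allP/(_ e e_mem)/allP/(_ b b_mem).
  move=> /allP/(_ y0 (mem_digits y0))/allP/(_ y1 (mem_digits y1)).
  by move=> /allP/(_ y2 (mem_digits y2))/allP; apply; exact: mem_digits.
case: l0 l1 l2 l3 => [b0 y0] [b1 y1] [b2 y2] [b3 y3].
(* A move flips all four bits, so if they do not all agree, both amplitudes are [None]. *)
by case: b0; case: b1; case: b2; case: b3 => //; exact: equal_bits.
Qed.

End KleinStrategy.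

Arguments site_move : simpl never.
Arguments site_phase : simpl never.
Arguments state_phase : simpl never.

(** * Extension to F_2^r *)

Section EmbeddedKleinGroup.
Variables (r : nat) (r_ge2 : (2 <= r)%N).
Local Notation P := (bool * bool)%type.
Local Notation H := 'rV['F_2]_r.

Definition klein_emb (p : P) : H :=
  \row_(k < r) ((k == 0 :> nat) && p.1 || (k == 1 :> nat) && p.2)%:R.

Definition klein_dec (a : H) : option P := [pick p | klein_emb p == a].

(** The two bits are read off at the coordinates 0 and 1, which exist as [r] is at least 2. *)
Lemma klein_emb_inj : injective klein_emb.
Proof.
move=> [p0 p1] [q0 q1] /rowP pq.
have bit_inj (b c : bool) : b%:R = c%:R :> 'F_2 -> b = c by case: b; case: c.
have := pq (Ordinal (leq_trans (isT : 0 < 2)%N r_ge2)).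
have := pq (Ordinal (leq_trans (isT : 1 < 2)%N r_ge2)).
by rewrite !mxE /= !orbF => /bit_inj -> /bit_inj ->.
Qed.

Lemma klein_embD p q : klein_emb (addP p q) = klein_emb p + klein_emb q.
Proof.
apply/rowP => k; rewrite !mxE; case: p q => [p0 p1] [q0 q1].
case: k => [[|[|k]] ? /=]; rewrite ?orbF.
- by case: p0; case: q0; apply/val_inj.
- by case: p1; case: q1; apply/val_inj.
- by rewrite addr0.
Qed.

Lemma klein_emb0 : klein_emb (false, false) = 0.
Proof. by apply/rowP => k; rewrite !mxE /= !andbF. Qed.

Lemma klein_embK p : klein_dec (klein_emb p) = Some p.
Proof.
rewrite /klein_dec; case: pickP => [q /eqP/klein_emb_inj -> //|/(_ p)].
by rewrite eqxx.
Qed.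

(** Translation by an element of the subgroup preserves its complement: from [a + p = q] follows
    [a = q + p], in characteristic 2. *)
Lemma klein_dec_None a p :
  klein_dec a = None -> klein_dec (a + klein_emb p) = None.
Proof.
rewrite /klein_dec; case: pickP => // a_out _; case: pickP => // q /eqP aE.
have := a_out (addP q p); rewrite klein_embD aE -addrA -klein_embD.
by rewrite /addP !addbb klein_emb0 addr0 eqxx.
Qed.

Lemma klein_dec_Some a p : klein_dec a = Some p -> a = klein_emb p.
Proof. by rewrite /klein_dec; case: pickP => // q /eqP <- [->]. Qed.

End EmbeddedKleinGroup.

(** * The observables and the joint eigenvector on four sites *)

Section KleinOperators.
Variable C : numClosedFieldType.
Local Notation P := (bool * bool)%type.
Local Notation site := (bool * 'Z_4)%type.
Local Notation space := (l2 C {ffun P -> site}).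

Definition klein_op (p q : P) : space -> space :=
  site_op p (site_move q) (fun l => chi8 C (site_phase p q l)).

HB.instance Definition _ p q := GRing.Linear.on (klein_op p q).

Definition klein_amplitude (x : {ffun P -> site}) : C :=
  if state_phase (x (false, false)) (x (false, true))
       (x (true, false)) (x (true, true)) is Some k then chi8 C k else 0.

Definition klein_vector : space := [ffun x => klein_amplitude x].

Lemma klein_vector_neq0 : klein_vector != 0.
Proof.
apply/eqP => /ffunP /(_ [ffun=> (false, 0)]); rewrite !ffunE.
by rewrite /klein_amplitude !ffunE => /eqP; rewrite /chi8 expr0 oner_eq0.
Qed.

(** At each basis vector both sides are either zero or powers of [zeta8], and [state_check] compares
    the exponents. *)
Lemma klein_clause (e : P + P) :
  (\big[comp/idfun]_(p <- bits) klein_op p (klein_query e p)) klein_vector =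
    (-1) ^+ (e == inr (false, false)) *: klein_vector.
Proof.
rewrite /bits /= !big_cons big_nil /=; apply/ffunP => x; rewrite !ffunE.
rewrite /klein_amplitude !ffunE /= -[RHS]/(_ * _) -chi8_sign.
have := state_checkP e (x (false, false)) (x (false, true))
  (x (true, false)) (x (true, true)).
rewrite /state_check.
case: (state_phase (x _)) => [k|]; case: state_phase => [k'|] //.
  by move=> /eqP check; rewrite -!chi8D check.
by rewrite !mulr0.
Qed.

End KleinOperators.

(** * The perfect strategy for the game of F_2^r *)

Section CayleyStrategy.
Variables (R : realType) (r : nat) (r_ge2 : (2 <= r)%N).
Local Notation P := (bool * bool)%type.
Local Notation site := (bool * 'Z_4)%type.
Local Notation H := 'rV['F_2]_r.
Local Notation G := (cayley_game R r).
Local Notation space := (l2 R[i] {ffun P -> site}).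

Definition cayley_obs (a j : H) : {linear space -> space} :=
  if klein_dec a is Some p then
    if klein_dec j is Some q then klein_op p q : {linear space -> space}
    else idfun
  else idfun.

Variant cayley_obs_spec (a j : H) : (space -> space) -> Type :=
| CayleyObsKlein p q of a = klein_emb r p & j = klein_emb r q :
    cayley_obs_spec a j (klein_op p q)
| CayleyObsId : cayley_obs_spec a j idfun.

Lemma cayley_obsP a j : cayley_obs_spec a j (cayley_obs a j).
Proof.
rewrite /cayley_obs; case aE: klein_dec => [p|]; last exact: CayleyObsId.
case jE: klein_dec => [q|]; last exact: CayleyObsId.
by apply: CayleyObsKlein; exact: klein_dec_Some.
Qed.

Let chi8_phase p q (l : site) :
  chi8 R[i] (site_phase p q l) * chi8 R[i] (site_phase p q (site_move q l)) = 1.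
Proof. by rewrite -chi8D site_phase_move. Qed.

Fact cayley_obs_norm a j v : `|cayley_obs a j v| = `|v|.
Proof.
case: cayley_obsP => // p q _ _.
by apply: norm_site_op => [|l|l]; [exact: site_moveK|exact: norm_chi8|].
Qed.

Fact cayley_obs_bounded a j : exists M : R[i],
  forall v, `|cayley_obs a j v| <= M * `|v|.
Proof. by exists 1 => v; rewrite mul1r cayley_obs_norm. Qed.

Fact cayley_obs_selfadjoint a j u v :
  l2_inner (cayley_obs a j u) v = l2_inner u (cayley_obs a j v).
Proof.
case: cayley_obsP => // p q _ _.
by apply: site_op_selfadjoint => [|l|l]; [exact: site_moveK|exact: norm_chi8|].
Qed.

Fact cayley_obs_involutive a j : involutive (cayley_obs a j).
Proof.
case: cayley_obsP => // p q _ _; apply: site_opK => [|l] //; exact: site_moveK.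
Qed.

Fact cayley_obs_commute a a' j j' : a != a' -> forall v,
  cayley_obs a j (cayley_obs a' j' v) = cayley_obs a' j' (cayley_obs a j v).
Proof.
case: cayley_obsP => // p q -> _; case: cayley_obsP => // p' q' -> _ pp' v.
by apply: site_op_comm; apply: contraNneq pp' => ->.
Qed.

Definition cayley_state : space := `|klein_vector R[i]|^-1 *: klein_vector R[i].

Fact cayley_state_unit : `|cayley_state| = 1.
Proof.
by rewrite normrZ normfV normr_id mulVf // normr_eq0 klein_vector_neq0.
Qed.

Definition cayley_strategy : co_strategy G :=
  (* The norm is by definition the square root of the inner product, whence [sqrtCK]. *)
  @COStrategy R G space (@l2_inner R[i] _) (fun v => esym (sqrtCK _))
    cayley_state cayley_state_unit cayley_obs cayley_obs_bounded
    cayley_obs_selfadjoint cayley_obs_involutive cayley_obs_commute.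

Definition klein_clause_emb (e : P + P) : clause G :=
  match e with inl q => inl (klein_emb r q) | inr q => inr (klein_emb r q) end.

Lemma query_klein_clause e p :
  query (klein_clause_emb e) (klein_emb r p) = klein_emb r (klein_query e p).
Proof. by case: e => q //=; rewrite klein_embD. Qed.

Local Notation U := (@co_prod R G cayley_strategy).

(** Players outside the subgroup act trivially, and on these clauses those inside receive questions
    of the subgroup. *)
Lemma co_prod_klein e v : U (klein_clause_emb e) v =
  (\big[comp/idfun]_(p <- bits) @klein_op R[i] p (klein_query e p)) v.
Proof.
have emb_inj := klein_emb_inj r_ge2.
rewrite /co_prod (@comp_prod_support _ _ _ _ (map (klein_emb r) bits)).
- rewrite big_map; apply: eq_comp_prod => p _ x.
  by rewrite query_klein_clause /= /cayley_obs !klein_embK.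
- exact: index_enum_uniq.
- by rewrite (map_inj_uniq emb_inj).
- by move=> a _; rewrite mem_index_enum.
- by move=> a b ab x; exact: cayley_obs_commute.
move=> a /negP a_out x; rewrite /= /cayley_obs.
case aE: klein_dec => [p|//]; case: a_out.
by rewrite (klein_dec_Some aE) map_f ?mem_bits.
Qed.

Lemma co_prod_not_klein (e : clause G) v :
  (forall p, klein_dec (query e (klein_emb r p)) = None) -> U e v = v.
Proof.
move=> e_out; apply: comp_prod_id => a _ x; rewrite /= /cayley_obs.
by case aE: (klein_dec a) => [p|//]; rewrite (klein_dec_Some aE) e_out.
Qed.

Lemma cayley_strategy_perfect : co_perfect cayley_strategy.
Proof.
have klein_perfect e : U (klein_clause_emb e) cayley_state =
    (-1) ^+ (e == inr (false, false)) *: cayley_state.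
  rewrite /cayley_state co_prod_scale co_prod_klein klein_clause.
  by rewrite !scalerA mulrC.
have dec0 : klein_dec (0 : H) = Some (false, false).
  by rewrite -(klein_emb0 r) klein_embK.
have emb_eq0 q : (klein_emb r q == 0) = (q == (false, false)).
  by rewrite -(klein_emb0 r) (inj_eq (klein_emb_inj r_ge2)).
(* If [g] lies in the subgroup, the clause is one of the eight already verified. Otherwise its four
   active players only see questions with trivial observables, and its target is even because [0] is
   in the subgroup. *)
case=> g; case gE: (klein_dec g) => [q|].
- by rewrite (klein_dec_Some gE); exact: (klein_perfect (inl q)).
- by rewrite co_prod_not_klein // scale1r.
- rewrite (klein_dec_Some gE) [LHS](klein_perfect (inr q)).
  by congr ((-1) ^+ nat_of_bool _ *: _); exact/esym/emb_eq0.
rewrite co_prod_not_klein => [|p]; last exact: klein_dec_None.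
rewrite (_ : target _ = false) ?scale1r //.
by apply/eqP => -[g0]; rewrite g0 dec0 in gE.
Qed.

End CayleyStrategy.

Theorem theorem4p2 (R : realType) (r : nat) (hr : (2 <= r)%N) :
  [/\ is_PREF (@cayley_assignment R r),
      ~ (exists w : seq (clause (cayley_game R r)), true_refutation w),
      co_value (cayley_game R r) = 1 &
      ~ (exists theta : merp_strategy (cayley_game R r), merp_perfect theta)].
Proof.
have perfect := @cayley_strategy_perfect R r hr.
split; first exact: cayley_PREF.
- by move=> [w]; exact: co_perfect_no_refutation perfect.
- apply: co_value_perfect perfect => [e|]; first by rewrite invr_ge0.
  rewrite sumr_const card_sum /= addnn -mul2n -[LHS]mulr_natr mulVf //.
  by rewrite pnatr_eq0 muln_eq0 /= -lt0n; apply/card_gt0P; exists 0.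
- by move=> [theta]; exact: cayley_no_perfect_merp.
Qed.
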